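(* Let $u\geq v\geq 0$ be integers, and for each integer $r\ge 2$ put $p=r+u$ and $q=r+v$. Then, for all sufficiently large $r$ (in terms of $u$ and $v$), there exists an explicit real number $\eta_{u,v}(r)>0$ such that for every $\varepsilon>0$ and all $B\ge 1$, \[ N(B)\ll_{\varepsilon,u,v,r} B^{\frac1p+\frac1q-\eta_{u,v}(r)+\varepsilon}, \] where, as a function of $r$ with $u,v$ fixed, \[ \eta_{u,v}(r)=\frac1{r^2}+O_{u,v}(r^{-5/2}). \]
   Context: For an integer $m\ge 2$, a nonzero integer $n$ is called $m$-full if for every prime $\ell$ either $v_\ell(n)=0$ or $v_\ell(n)\ge m$, where $v_\ell$ is the $\ell$-adic valuation. Let $\mathcal S_m$ denote the set of positive $m$-full integers (so $1\in\mathcal S_m$). For integers $p,q,r\ge 2$, define \[ N(B)=\#\left\{(a,b,c)\in(\mathcal S_p\times\mathcal S_q\times\mathcal S_r)\cap[1,B]^3:\ \gcd(a,b,c)=1,\ a+b=c\right\}. \] The notation $\ll$ and $O(\cdot)$ with subscripts means that the implied constant depends only on the subscripted parameters. *)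

(* Defs.v *)
From mathcomp Require Import all_boot all_order all_algebra.
From mathcomp Require Import finmap.
From mathcomp Require Import all_classical all_reals all_analysis.

Set Implicit Arguments.
Unset Strict Implicit.
Unset Printing Implicit Defensive.

Import Order.TTheory GRing.Theory Num.Theory.

Local Open Scope classical_set_scope.
Local Open Scope ring_scope.

Definition mfull (m n : nat) : Prop :=
  n <> 0%N /\ forall l : nat, prime l -> logn l n = 0%N \/ (m <= logn l n)%N.

Definition S_ (m : nat) : set nat := [set n : nat | (0 < n)%N /\ mfull m n].

Definition abc_triples (R : realType) (p q r : nat) (B : R) :
    set (nat * nat * nat) :=
  [set t | let: (a, b, c) := t in
    [/\ S_ p a, S_ q b & S_ r c] /\
    [/\ (a%:R : R) \in `[1, B], (b%:R : R) \in `[1, B] & (c%:R : R) \in `[1, B]] /\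
    gcdn a (gcdn b c) = 1%N /\ (a + b = c)%N].

Lemma finite_abc_triples (R : realType) (p q r : nat) (B : R) :
  finite_set (abc_triples p q r B).
Proof.
have fI : finite_set `I_(Num.truncn B).+1 by exact: finite_II.
apply: (sub_finite_set _ (finite_setX (finite_setX fI fI) fI)).
have bnd k : (k%:R : R) \in `[1, B] -> `I_(Num.truncn B).+1 k.
  rewrite in_itv => /andP[k1 kB] /=; rewrite ltnS truncn_ge_nat //.
  exact: le_trans (le_trans ler01 k1) kB.
by move=> [[a b] c] /= [_ [[/bnd ? /bnd ? /bnd ?] _]].
Qed.

(* [fset_set] is only meaningful on finite sets: see [finite_abc_triples]. *)
Definition N (R : realType) (p q r : nat) (B : R) : nat :=
  #|` fset_set (abc_triples p q r B)|%fset.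

(* Main.v *)
Require Import Defs.
From mathcomp Require Import all_boot all_order all_algebra.
From mathcomp Require Import all_field finmap.
From mathcomp Require Import all_classical all_reals all_analysis.
From mathcomp Require Import zify ring lra.

Import Order.TTheory GRing.Theory Num.Theory.

(** Write [a = a' x^p] and [b = b' y^q], where [x] collects the primes of [a]
    of exponent exactly [p], so that [a'] is [(p+1)]-full, and similarly for
    [b].  Put [d = (7 + 2u)/r] and split the solutions according to the size
    of [a' b'].

    If [a' b' >= B^(1-d)], the pair [(a, b)] is unusual already on its own:
    there are about [A^(1/(p+1))] possible [a'] of size [A], against
    [A^(1/p)] for [x^p].  Rankin's trick turns this into a bound
    [B^(1/p + 1/q + eps)] times [B^(-(1-d)/(p(p+1)))]
    ([count_small_main_parts]), and the last exponent is the saving: it is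
    [1/r^2 + O(r^-3)].

    If [a' b' < B^(1-d)], fix [a'], [b'] and [c].  There are at most
    [B^((2-d)/r + eps)] such triples, and each of them leaves
    [O(B^(6/r^2))] points [(x, y)] on the curve [a' x^p + b' y^q = c]
    ([superelliptic_points_bound]); by the choice of [d] the product is within
    the target ([count_large_main_parts], [large_case_exponent]).

    The bound for points on the curve is an [l]-adic determinant method with
    the determinant replaced by the pigeonhole principle.  Fix a prime
    [l > p, q].  As [gcd(a, b) = 1], [l] misses one of [a], [b], say [b], and
    then it misses the derivative [q b' y^(q-1)].  Hensel lifting gives an
    integer polynomial [g] such that [y] is congruent to [g(x)] modulo a high
    power of [l], for all points with a given residue of [y] modulo [l]
    ([hensel_power_curve]).  By pigeonhole there is a nonzero [G(X, Y)] with
    coefficients at most [Q^(r^2)], [Q = l^k], of degree less than [2r] in [X]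
    and less than [r] in [Y], such that [G(x, g(x))] is divisible by
    [Q^(2 r^2)] for all [x] in a residue class modulo [Q^2]
    ([small_auxiliary_polynomial]).  At a point of the curve the integer
    [G(x, y)] is thus divisible by [Q^(2 r^2)], while its absolute value is
    at most [2 r^2 Q^(r^2) B^3]; if [Q^(r^2)] exceeds [2 r^2 B^3] it is zero.
    So each of the [Q^2 l = O(B^(6/r^2))] classes lies on a curve [G = 0], and
    by elimination it has boundedly many points: [G] has no factor in common
    with the equation of the curve, because the [Y]-degree of a factor of
    [Y^q - w(X)] is a multiple of [q] when [w] has a simple root
    ([degree_factor_XnsubC], [curve_auxiliary_zeros]). *)

(** * Factoring full numbers *)

(** Full numbers with a prescribed set [E] of exponents: [full_in (leq m)] is
    the set of [m]-full numbers.  Other sets [E] are needed to peel off one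
    exponent after the other. *)
Definition full_in (E : pred nat) (a : nat) : bool :=
  (0 < a) && all (fun l => E (logn l a)) (primes a).

(** A prime whose exponent lies outside [E'] gives up [j] units of its exponent
    to the [j]-th power; the hypothesis says that what remains is again an
    allowed exponent, so that the process goes on, and it stops because the
    number decreases. *)
Lemma full_in_split (E E' : pred nat) j a : 0 < j ->
  (forall e, E e -> E' e \/ (j <= e /\ (e = j \/ E (e - j)))) ->
  full_in E a -> exists x z, [/\ 0 < x, full_in E' z & a = x ^ j * z].
Proof.
move=> j0 EE'; elim/ltn_ind: a => a IH /andP[a0 /allP Ea].
have [E'a|] := boolP (all (fun l => E' (logn l a)) (primes a)).
  by exists 1, a; rewrite exp1n mul1n /full_in a0.
case/allPn => l la nE'; have [lp _ _] := and3P (etrans (esym (mem_primes l a)) la).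
have [|[je Ee]] := EE' _ (Ea _ la); first by rewrite (negPf nE').
have /dvdnP[a2 aE] : l ^ j %| a by rewrite pfactor_dvdn.
have lj0 : 0 < l ^ j by rewrite expn_gt0 prime_gt0.
have a20 : 0 < a2 by move: a0; rewrite aE muln_gt0 => /andP[].
have logE k : logn k a = logn k a2 + logn k (l ^ j) by rewrite aE lognM.
have [||x [z [x0 Ez a2E]]] := IH a2.
- by rewrite aE ltn_Pmulr // -(expn0 l) ltn_exp2l ?prime_gt1.
- rewrite /full_in a20; apply/allP => k ka2.
  have [kp _ ka] := and3P (etrans (esym (mem_primes k a2)) ka2).
  have kpa : k \in primes a by rewrite mem_primes kp a0 aE dvdn_mulr.
  have ka20 : 0 < logn k a2 by rewrite logn_gt0.
  have [kl|kl] := eqVneq k l.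
    move: Ee; rewrite -kl logE kl pfactorK // addnK -kl => -[|//].
    by move/eqP; rewrite -{2}[j]add0n eqn_add2r eqn0Ngt ka20.
  have := Ea _ kpa; rewrite logE lognX (logn_prime _ lp).
  by rewrite (negPf kl) muln0 addn0.
exists (l * x), z; split=> //; first by rewrite muln_gt0 prime_gt0.
by rewrite aE a2E expnMn; ring.
Qed.

Lemma full_in_only1 (E : pred nat) a : (forall e, ~~ E e) -> full_in E a -> a = 1.
Proof.
move=> nE /andP[a0 /allP aE]; apply/eqP; rewrite eqn_leq a0 andbT leqNgt.
apply/negP => a1; have := aE (pdiv a); rewrite (negPf (nE _)) mem_primes.
by rewrite pdiv_prime // a0 pdiv_dvd => /(_ isT).
Qed.

(** * Sums over full numbers *)

Local Open Scope ring_scope.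

(** Comparison of sums along a relation under which every [i] has a partner and
    no [j] serves two different [i]: this is how a sum over numbers is compared
    with a sum over their factorizations, without choosing a factorization. *)
Lemma ler_sum_cover (R : realDomainType) (I J : finType) (P : pred I) (Q : pred J)
    (rel : I -> J -> bool) (F : I -> R) (G : J -> R) :
  (forall i, P i -> exists2 j, Q j & rel i j) ->
  (forall i i' j, rel i j -> rel i' j -> i = i') ->
  (forall i j, P i -> Q j -> rel i j -> F i <= G j) ->
  (forall j, Q j -> 0 <= G j) ->
  \sum_(i | P i) F i <= \sum_(j | Q j) G j.
Proof.
move=> cov inj FG G0.
apply: le_trans (_ : \sum_(i | P i) \sum_(j | Q j && rel i j) G j <= _).
  apply: ler_sum => i Pi; have [j Qj ij] := cov i Pi.
  rewrite (bigD1 j) ?Qj //= (le_trans (FG _ _ Pi Qj ij)) // lerDl.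
  by apply: sumr_ge0 => k /andP[/andP[/G0 ? _] _].
rewrite (exchange_big_dep Q) /=; last by move=> i j _ /andP[].
apply: ler_sum => j Qj.
have [/existsP[i /andP[Pi ij]]|nex] := boolP [exists i, P i && rel i j].
  rewrite (bigD1 i) ?Pi ?Qj //= big1 ?addr0 // => k /andP[/andP[_ kj]].
  by rewrite (inj _ _ _ kj ij) eqxx.
rewrite big_pred0 ?G0 // => i; apply/negP => /and3P[Pi _ ij].
by case/existsP: nex; exists i; rewrite Pi.
Qed.

(** With [k = s - 1], the term at [m = n + 1] is at most
    [(n^-k - m^-k) / k], since [(1 - 1/m)^-k >= 1 + k/m]; so the sum
    telescopes. *)
Lemma zeta_partial_sum_bound (R : realType) (s : R) : 1 < s ->
  exists C : R, forall n, \sum_(x < n.+1 | (0 < x)%N) (x%:R : R) `^ (- s) <= C.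
Proof.
move=> s1; pose k := s - 1; have k0 : 0 < k by rewrite subr_gt0.
have step n : (n.+2%:R : R) `^ (- s) <= k^-1 * (n.+1%:R `^ (- k) - n.+2%:R `^ (- k)).
  rewrite -ler_pdivrMl ?invr_gt0 // invrK.
  have n1 : (n.+1%:R : R) != 0 by rewrite pnatr_eq0.
  have n2 : (n.+2%:R : R) != 0 by rewrite pnatr_eq0.
  have -> : (n.+2%:R : R) `^ (- s) = n.+2%:R `^ (- k) / n.+2%:R.
    have -> : - s = - k + - 1 by rewrite /k; ring.
    by rewrite powRD ?n2 ?implybT // powR_inv1 ?ler0n.
  rewrite lerBrDr mulrCA -{2}[_ `^ (- k)]mulr1 -mulrDr.
  have nE : (n.+1%:R : R) = n.+2%:R * (1 - n.+2%:R^-1).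
    by rewrite mulrBr divff // mulr1 -[n.+2]addn1 natrD addrK.
  have t0 : (0 : R) < 1 - n.+2%:R^-1.
    by rewrite subr_gt0 invf_lt1 ?ltr0n // ltr1n.
  rewrite nE powRM ?ler0n // ?(ltW t0) // ler_pM2l ?powR_gt0 ?ltr0n //.
  rewrite /powR gt_eqF //; apply: le_trans (expR_ge1Dx _).
  rewrite addrC lerD2l mulNr -mulrN ler_pM2l // lerNr.
  by apply: le_ln1Dx; rewrite ltrN2 invf_lt1 ?ltr0n // ltr1n.
exists (1 + k^-1) => n.
suff : \sum_(x < n.+2 | (0 < x)%N) (x%:R : R) `^ (- s) <= 1 + k^-1 - k^-1 * n.+1%:R `^ (- k).
  rewrite big_mkcond big_ord_recr -big_mkcond /= => H.
  have := powR_ge0 (n.+1%:R : R) (- s); have : 0 <= k^-1 * n.+1%:R `^ (- k).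
    by rewrite mulr_ge0 ?powR_ge0 // ltW // invr_gt0.
  by move: H; set a := \sum_(_ < _ | _) _; set b := _ `^ _; set c := _ * _; lra.
elim: n => [|n IH].
  rewrite big_mkcond !big_ord_recr big_ord0 /= !powR1; lra.
rewrite big_mkcond big_ord_recr -big_mkcond /=.
by have := step n; move: IH; lra.
Qed.

Definition full_sum (R : realType) (E : pred nat) (s : R) (n : nat) : R :=
  \sum_(a < n.+1 | full_in E a) (a%:R : R) `^ (- s).
Arguments full_sum {R} E s n.

Lemma full_sum_split (R : realType) (E E' : pred nat) (j : nat) (s : R) n : (0 < j)%N ->
  (forall e, E e -> E' e \/ ((j <= e)%N /\ (e = j \/ E (e - j)%N))) ->
  full_sum E s n <=
    (\sum_(x < n.+1 | (0 < x)%N) (x%:R : R) `^ (- (s * j%:R))) * full_sum E' s n.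
Proof.
move=> j0 EE'; rewrite /full_sum big_distrlr pair_big /=.
apply: (@ler_sum_cover R _ _ _ _ (fun (i : 'I_n.+1) (t : 'I_n.+1 * 'I_n.+1) => i == t.1 ^ j * t.2 :> nat)%N).
- move=> a /(full_in_split _ _ _ _ j0 EE')[x [z [x0 Ez aE]]].
  have z0 : (0 < z)%N by case/andP: Ez.
  have xa : (x < n.+1)%N.
    apply: leq_ltn_trans (ltn_ord a); rewrite aE.
    by rewrite (leq_trans _ (leq_pmulr _ z0)) // -{1}[x]expn1 leq_pexp2l.
  have za : (z < n.+1)%N.
    by apply: leq_ltn_trans (ltn_ord a); rewrite aE leq_pmull // expn_gt0 x0.
  by exists (Ordinal xa, Ordinal za); rewrite /= ?x0 ?Ez // aE.
- by move=> i i' t /eqP <- /eqP /ord_inj.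
- move=> i [x z] _ /= /andP[x0 Ez] /eqP->; rewrite natrM natrX powRM ?exprn_ge0 ?ler0n //.
  by rewrite -powR_mulrn ?ler0n // -powRrM mulrN (mulrC j%:R).
- by move=> [x z] _ /=; apply: mulr_ge0; exact: powR_ge0.
Qed.

Lemma full_sum_ge0 (R : realType) E (s : R) n : 0 <= full_sum E s n.
Proof. by apply: sumr_ge0 => a _; rewrite powR_ge0. Qed.

(** After one step all exponents lie in [[m+1, 2m-1]]; the exponents [m+1],
    [m+2], and so on are then removed one at a time, each at the cost of a
    factor [zeta(s j)] with [j >= m], until only the number [1] is left. *)
Lemma full_sum_bounded (R : realType) (m : nat) (s : R) : (0 < m)%N -> 1 < s * m%:R ->
  exists2 C : R, 0 < C & forall n, full_sum (leq m) s n <= C.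
Proof.
move=> m0 sm.
have s0 : 0 < s.
  by rewrite -(pmulr_lgt0 _ (_ : 0 < m%:R)) ?ltr0n // (lt_trans _ sm).
have zeta j : (m <= j)%N -> exists C : R, forall n,
    \sum_(x < n.+1 | (0 < x)%N) (x%:R : R) `^ (- (s * j%:R)) <= C.
  move=> mj; apply: zeta_partial_sum_bound; apply: lt_le_trans sm _.
  by rewrite ler_pM2l // ler_nat.
have zeta0 j n : 0 <= \sum_(x < n.+1 | (0 < x)%N) (x%:R : R) `^ (- (s * j%:R)).
  by apply: sumr_ge0 => x _; rewrite powR_ge0.
have step (E E' : pred nat) j : (m <= j)%N ->
    (forall e, E e -> E' e \/ ((j <= e)%N /\ (e = j \/ E (e - j)%N))) ->
    (exists C : R, forall n, full_sum E' s n <= C) ->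
    exists C : R, forall n, full_sum E s n <= C.
  move=> mj EE' [C CP]; have [D DP] := zeta j mj; exists (D * C) => n.
  apply: le_trans (full_sum_split R E E' j s n (leq_trans m0 mj) EE') _.
  by rewrite ler_pM ?full_sum_ge0.
have trunc i : (i <= m)%N -> exists C : R, forall n,
    full_sum (fun e => 2 * m - i <= e < 2 * m)%N s n <= C.
  elim: i => [|i IH] im.
    exists 1 => n; rewrite /full_sum.
    set E := (fun e : nat => _).
    have E1 a : full_in E a -> a = 1%N.
      by apply: full_in_only1 => e; rewrite /E; apply/negP; lia.
    rewrite (eq_bigr (fun=> 1)); last by move=> a /E1 ->; rewrite powR1.
    rewrite sumr_const -[leRHS]mulr1n ler_wpMn2l ?ler01 //.
    by apply/card_le1_eqP => a b /E1 a1 /E1 b1; apply: ord_inj; rewrite a1 b1.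
  apply: (step _ _ (2 * m - i.+1)%N _ _ (IH (ltnW im))); first by lia.
  by move=> e eE; have [->|] := eqVneq e (2 * m - i.+1)%N; [right; split; [|left] | left; lia].
have [C CP] : exists C : R, forall n, full_sum (leq m) s n <= C.
  apply: (step _ _ m (leqnn m) _ (trunc m.-1 (leq_pred m))) => e me.
  have [e2|e2] := ltnP e (2 * m)%N; last by right; split=> //; right; lia.
  by have [->|] := eqVneq e m; [right; split; [|left] | left; lia].
exists (Num.max C 1) => [|n]; first by rewrite lt_max ltr01 orbT.
by rewrite le_max CP.
Qed.

(** * Factors of [Y^q - w(X)] *)

Local Notation "x %:F" := (FracField.tofrac x).

Lemma fraction_numden (D : idomainType) (x : {fraction D}) :
  exists2 nd : D * D, nd.2 != 0 & x * (nd.2)%:F = (nd.1)%:F.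
Proof.
elim/generic_quotient.quotW: x => x; exists (frac x); first exact: denom_ratioP.
unlock FracField.tofrac; rewrite -[LHS]FracField.pi_mul.
apply/generic_quotient.eqmodP; rewrite /= FracField.equivfE.
rewrite /FracField.mulf !numden_Ratio ?oner_neq0 ?mulf_neq0 ?denom_ratioP //.
all: by rewrite ?mulr1 ?oner_neq0 ?denom_ratioP // mulrC.
Qed.

Lemma mupX (K : fieldType) (x : K) (f : {poly K}) n :
  f != 0 -> mup x (f ^+ n) = (n * mup x f)%N.
Proof.
move=> f0; elim: n => [|n IHn].
  by rewrite expr0 mul0n; apply: mupNroot; rewrite root1.
by rewrite exprS mupM ?expf_neq0 // IHn mulSn.
Qed.

(** Let [C] be the companion matrix of a factor [h].  It satisfies
    [C^q = w], and taking determinants shows that [w^(deg h)] is a [q]-th power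
    in [K(X)].  Comparing orders at the simple root [rho] of [w] gives
    [q | deg h]. *)
Lemma degree_factor_XnsubC (K : fieldType) (q : nat) (w : {poly K}) (rho : K)
    (h : {poly {fraction {poly K}}}) :
  w != 0 -> mup rho w = 1%N -> h \is monic -> h %| 'X^q - (w%:F)%:P ->
  (q %| (size h).-1)%N.
Proof.
move=> w0 mw hmon hdvd.
have [h1|h1] := leqP (size h).-1 0.
  by move: h1; rewrite leqn0 => /eqP->; rewrite dvdn0.
pose C := companionmx h.
have CK : char_poly C = h by exact: companionmxK.
move: C CK h1; rewrite /= ; case E : (size h).-1 => [//|d] C CK _.
have hC : horner_mx C h = 0 by rewrite -{1}CK Cayley_Hamilton.
have /eqP : horner_mx C ('X^q - (w%:F)%:P) = 0.
  by have /dvdpP[k ->] := hdvd; rewrite rmorphM /= hC mulr0.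
rewrite rmorphB /= rmorphXn /= horner_mx_X horner_mx_C subr_eq0 => /eqP CE.
have detE : (\det C) ^+ q = w%:F ^+ d.+1.
  rewrite -[RHS](det_scalar d.+1 w%:F) -CE; elim: (q) => [|n IHn]; first by rewrite !expr0 det1.
  by rewrite !exprS IHn -det_mulmx.
have [[n m] /= m0 nmE] := fraction_numden _ (\det C).
have : n ^+ q = w ^+ d.+1 * m ^+ q.
  apply/eqP; rewrite -tofrac_eq rmorphM !rmorphXn /= -nmE exprMn detE.
  by rewrite eqxx.
move=> nE.
have n0 : n != 0.
  apply/eqP => n0; move/eqP: nE; rewrite n0 expr0n.
  have [q0|q0] := eqVneq q 0%N; last first.
    by rewrite eq_sym mulf_eq0 !expf_eq0 (negPf w0) (negPf m0) !andbF.
  rewrite q0 expr0 mulr1 eq_sym => /eqP wE.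
  by have := mupX _ rho _ d.+1 w0; rewrite wE mw muln1 mupNroot ?root1.
have := congr1 (mup rho) nE.
rewrite mupM ?expf_neq0 // !mupX // mw muln1 => qE.
have : (q %| d.+1 + q * mup rho m)%N by rewrite -qE dvdn_mulr.
by rewrite dvdn_addl ?dvdn_mulr.
Qed.

Lemma resultant_XnsubC_neq0 (K : fieldType) (q : nat) (w : {poly K}) (rho : K)
    (G : {poly {poly K}}) :
  w != 0 -> mup rho w = 1%N -> G != 0 -> (size G <= q)%N ->
  resultant ('X^q - w%:P) G != 0.
Proof.
move=> w0 mw G0 sG; rewrite resultant_eq0 -leqNgt.
set F := 'X^q - w%:P; set h := gcdp F G.
have h0 : h != 0 by rewrite gcdp_eq0 (negPf G0) andbF.
have sh : (size h <= q)%N.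
  by apply: leq_trans sG; rewrite Pdiv.Idomain.dvdp_leq // Pdiv.Idomain.dvdp_gcdr.
have [/= [c k] c0 cE] := Pdiv.Idomain.dvdpP _ _ (Pdiv.Idomain.dvdp_gcdl F G).
pose f : {poly {poly K}} -> {poly {fraction {poly K}}} := map_poly (@FracField.tofrac {poly K}).
have lch : lead_coef h != 0 by rewrite lead_coef_eq0.
have szf g : size (f g) = size g.
  apply: size_map_inj_poly.
    by move=> x y /eqP; rewrite tofrac_eq => /eqP.
  exact: tofrac0.
pose l := lead_coef (f h).
have l0 : l != 0 by rewrite lead_coef_eq0 -size_poly_eq0 szf size_poly_eq0.
have hmon : l^-1 *: f h \is monic by rewrite monicE lead_coefZ mulVf.
have sh1 : size (l^-1 *: f h) = size h by rewrite size_scale ?invr_eq0 // szf.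
have fF : f F = 'X^q - (w%:F)%:P by rewrite /f rmorphB /= rmorphXn /= map_polyX map_polyC.
have hdvd : l^-1 *: f h %| 'X^q - (w%:F)%:P.
  rewrite dvdpZl ?invr_eq0 // -fF -(dvdpZr (f h) (f F) (_ : c%:F != 0)) ?tofrac_eq0 //.
  have -> : c%:F *: f F = f k * f h.
    rewrite /f -rmorphM -cE.
    by rewrite /= map_polyZ.
  exact: dvdp_mull.
have := degree_factor_XnsubC _ _ _ _ _ w0 mw hmon hdvd.
rewrite sh1; case: (size h) sh => [|[|s]] //= sq /dvdn_leq.
by move/(_ isT); rewrite leqNgt sq.
Qed.

(** * Common zeros of the curve and an auxiliary polynomial *)

Lemma size_det_leq (K : fieldType) n s (M : 'M[{poly K}]_n) :
  (forall i j, (size (M i j) <= s.+1)%N) -> (size (\det M) <= (n * s).+1)%N.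
Proof.
move=> sM; rewrite /determinant; apply: leq_trans (size_sum _ _ _) _.
apply/bigmax_leqP => t _; rewrite mulr_sign.
have -> (b : bool) (f : {poly K}) : size (if b then - f else f) = size f.
  by case: b; rewrite ?size_polyN.
apply: leq_trans (size_prod_leq _ _) _.
rewrite leq_subLR; apply: leq_trans (_ : \sum_(i < n) s.+1 < _)%N.
  by rewrite ltnS; apply: leq_sum => i _; apply: sM.
by rewrite sum_nat_const card_ord; lia.
Qed.

Lemma size_resultant_leq (K : fieldType) s (F G : {poly {poly K}}) :
  (forall i, (size (F`_i)%R <= s.+1)%N) -> (forall i, (size (G`_i)%R <= s.+1)%N) ->
  (size (resultant F G) <= (((size G).-1 + (size F).-1) * s).+1)%N.
Proof.
move=> sF sG; apply: size_det_leq => i j; rewrite Sylvester_mxE.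
by case: (fintype.split i) => k /=; rewrite mulrb; case: ifP => _ //; rewrite size_poly0.
Qed.

Lemma mup_simple_root (p : nat) (a c : algC) :
  (0 < p)%N -> a != 0 -> c != 0 ->
  exists2 rho : algC, c%:P - a *: 'X^p != 0 & mup rho (c%:P - a *: 'X^p) = 1%N.
Proof.
move=> p0 a0 c0; pose rho := p.-root (c / a).
have rE : rho ^+ p = c / a by rewrite rootCK.
have r0 : rho != 0.
  have : rho ^+ p != 0 by rewrite rE mulf_neq0 ?invr_eq0.
  by rewrite expf_eq0 p0.
set w := _ - _.
have w0 : w != 0.
  apply/eqP => /(congr1 (fun f => f.[0])).
  by rewrite !hornerE expr0n eqn0Ngt p0 => /eqP; rewrite mulr0 subr0 (negPf c0).
exists rho => //; apply/eqP; rewrite eqn_leq mup_leq // -XsubC_dvd // dvdp_XsubCl.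
rewrite rootE !hornerE rE mulrCA divff // mulr1 subrr eqxx andbT.
apply/negP => /dvdpP[k wE].
have : w^`().[rho] = 0.
  by rewrite wE expr2 mulrA derivM hornerD !hornerM !hornerE subrr ?(mulr0, mul0r, addr0).
rewrite derivB derivC sub0r derivZ derivXn hornerN hornerZ hornerMn hornerXn.
move/eqP; rewrite oppr_eq0 mulf_eq0 (negPf a0) /= mulrn_eq0.
by rewrite eqn0Ngt p0 expf_eq0 (negPf r0) andbF.
Qed.

(** The resultant in [Y] of the two equations is a nonzero polynomial in [X] of
    bounded degree that vanishes at the abscissa of every common zero, and the
    abscissa of a point of the curve with positive coordinates determines its
    ordinate.  The bound depends on the degrees only, so that it is
    uniform in the curve and in the auxiliary polynomial. *)
Lemma curve_auxiliary_zeros (p q d e : nat) : (0 < p)%N -> (0 < q)%N -> (e <= q)%N ->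
  exists K : nat, forall (a b c : nat) (v : nat -> nat -> int) i0 j0,
    (0 < a)%N -> (0 < b)%N -> (0 < c)%N ->
    (i0 < d)%N -> (j0 < e)%N -> v i0 j0 != 0 ->
    forall s : seq (nat * nat), uniq s ->
    (forall z, z \in s -> (a * z.1 ^ p + b * z.2 ^ q)%N = c /\
       \sum_(i < d) \sum_(j < e) v i j * z.1%:Z ^+ i * z.2%:Z ^+ j = 0) ->
    (size s <= K)%N.
Proof.
move=> p0 q0 eq; exists ((e + q) * (p + d)).+1%N.
move=> a b c v i0 j0 a0 b0 c0 i0d j0e v0 s us sP.
have nz n : (0 < n)%N -> n%:R != 0 :> algC by rewrite pnatr_eq0 lt0n.
have [rho w0 mw] := mup_simple_root p (a%:R / b%:R) (c%:R / b%:R) p0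
  (mulf_neq0 (nz _ a0) (invr_neq0 (nz _ b0)))
  (mulf_neq0 (nz _ c0) (invr_neq0 (nz _ b0))).
set w := _ - _ in w0 mw.
pose Gc j : {poly algC} := \poly_(i < d) (v i j)%:~R.
pose G : {poly {poly algC}} := \poly_(j < e) Gc j.
have Gcj0 : Gc j0 != 0.
  apply/eqP => /polyP/(_ i0); rewrite coef_poly i0d coef0 => /eqP.
  by rewrite intr_eq0 (negPf v0).
have G0 : G != 0.
  by apply/eqP => /polyP/(_ j0); rewrite coef_poly j0e coef0; apply/eqP.
have sGc j : (size (Gc j) <= d)%N by exact: size_poly.
have sG : (size G <= e)%N by exact: size_poly.
pose F : {poly {poly algC}} := 'X^q - w%:P.
have Fs : size F = q.+1.
  by rewrite /F size_polyDl ?size_polyXn // size_polyN size_polyC ltnS; case: (w != 0).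
have R0 : resultant F G != 0.
  by apply: resultant_XnsubC_neq0 w0 mw G0 _; apply: leq_trans sG eq.
have sw : (size w <= (p + d).+1)%N.
  rewrite /w; apply: leq_trans (size_polyD _ _) _; rewrite size_polyN geq_max.
  rewrite (leq_trans (size_polyC_leq1 _)) //=.
  by rewrite (leq_trans (size_scale_leq _ _)) // size_polyXn ltnS leq_addr.
have sR : (size (resultant F G) <= ((e + q) * (p + d)).+1)%N.
  apply: (leq_trans (@size_resultant_leq _ (p + d) _ _ _ _)).
  - move=> i; rewrite coefB coefXn coefC.
    apply: leq_trans (size_polyD _ _) _; rewrite size_polyN geq_max.
    by case: (i == q); case: (i == 0)%N; rewrite ?size_poly1 ?size_poly0 ?sw.
  - move=> i; rewrite coef_poly; case: ifP => _; last by rewrite size_poly0.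
    by apply: leq_trans (sGc i) _; lia.
  - by rewrite Fs ltnS leq_mul // leq_add // (leq_trans (leq_pred _)).
have evalF z : z \in s -> F.[(z.2%:R)%:P].[z.1%:R] = 0.
  move=> /sP[zE _]; rewrite /F !hornerE /w -zE natrD !natrM !natrX.
  rewrite mulrDl [b%:R * _]mulrC mulfK ?nz // [a%:R * _ / _]mulrAC.
  ring.
have evalG z : z \in s -> G.[(z.2%:R)%:P].[z.1%:R] = 0.
  move=> /sP[_ zE]; rewrite /G horner_poly horner_sum.
  transitivity ((\sum_(i < d) \sum_(j < e) v i j * z.1%:Z ^+ i * z.2%:Z ^+ j)%:~R : algC);
    last by rewrite zE.
  rewrite exchange_big /= rmorph_sum /=; apply: eq_bigr => j _.
  rewrite !hornerE horner_poly mulr_suml rmorph_sum; apply: eq_bigr => i _.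
  by rewrite /= !rmorphM /= !rmorphXn /= !pmulrn.
pose xs := [seq z.1%:R : algC | z <- s].
have uxs : uniq xs.
  rewrite map_inj_in_uniq // => -[x y] [x' y'] /sP[/= E _] /sP[/= E' _] /eqP.
  rewrite eqr_nat => /eqP xx; rewrite -xx in E' *; congr pair.
  apply/eqP; rewrite -(eqn_exp2r _ _ q0) -(eqn_pmul2l b0).
  by rewrite -(eqn_add2l (a * x ^ p)) E E'.
(* [resultant_in_ideal] needs positive degrees in [Y]. *)
have [s1|s1] := leqP (size G) 1.
  have rxs : all (root G`_0) xs.
    apply/allP => _ /mapP[z zs ->]; rewrite rootE; have := evalG z zs.
    by rewrite (size1_polyC s1) hornerC coefC eqxx => ->.
  have G00 : G`_0 != 0.
    by move: G0; rewrite {1}(size1_polyC s1) polyC_eq0.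
  have := max_poly_roots G00 rxs uxs; rewrite size_map => /ltnW/leq_trans; apply.
  rewrite coef_poly; case: ifP => [e0|_]; last by rewrite size_poly0.
  apply: leq_trans (sGc _) _; apply: leqW; rewrite -[d]mul1n leq_mul //; lia.
have rxs : all (root (resultant F G)) xs.
  apply/allP => _ /mapP[z zs ->]; rewrite rootE.
  have F1 : (1 < size F)%N by rewrite Fs.
  have [[U V] _ /(congr1 (fun f => f.[(z.2%:R)%:P].[z.1%:R]))] :=
    resultant_in_ideal F1 s1.
  rewrite hornerC hornerD !hornerM hornerD !hornerM evalF // evalG // !mulr0.
  by rewrite addr0 => ->.
have := max_poly_roots R0 rxs uxs; by rewrite size_map => /ltnW/leq_trans; apply.
Qed.

(** * Hensel lifting and the auxiliary polynomial *)

Lemma dvdz_subX (d x y : int) n : (d %| x - y)%Z -> (d %| x ^+ n - y ^+ n)%Z.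
Proof. by move=> dxy; rewrite subrXX dvdz_mulr. Qed.

(** Newton iteration with the fixed approximate inverse [w] of the derivative
    [q b y0^(q-1)], carried out on polynomials in [X] rather than on numbers:
    one [g] then serves all points [(x, y)] with [y = y0] modulo [l], whatever
    [x] is.  If [y - z] is divisible by [l^m], [z = g(x)], the next error is
    [(y - z) (1 - w b S)] with [S = (y^q - z^q)/(y - z)], and [S] is congruent
    to [q y0^(q-1)] modulo [l]. *)
Lemma hensel_power_curve (l : int) (p q : nat) (a b c y0 : int) m :
  (0 < q)%N -> coprimez l (b * q%:Z * y0 ^+ q.-1) ->
  exists g : {poly int}, forall x y : int,
    a * x ^+ p + b * y ^+ q = c -> (l %| y - y0)%Z -> (l ^+ m %| y - g.[x])%Z.
Proof.
move=> q0; set dF := b * _ * _ => /coprimezP[[u w] /= uw].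
(* The induction starts at [l^1], the power modulo which [y0] is right. *)
suff [g gP] : exists g : {poly int}, forall x y : int,
    a * x ^+ p + b * y ^+ q = c -> (l %| y - y0)%Z -> (l ^+ m.+1 %| y - g.[x])%Z.
  exists g => x y E /(gP _ _ E); apply: dvdz_trans.
  by rewrite exprS dvdz_mull.
elim: m => [|m [g IH]].
  by exists y0%:P => x y _; rewrite hornerC expr1.
exists (g - w *: (b *: g ^+ q + a *: 'X^p - c%:P)) => x y E yy0.
have gy := IH x y E yy0; rewrite !hornerE; set z := g.[x] in gy *.
have zy0 : (l %| z - y0)%Z.
  have -> : z - y0 = (y - y0) - (y - z) by ring.
  by rewrite rpredB //; apply: dvdz_trans gy; rewrite exprS dvdz_mulr.
pose S := \sum_(i < q) y ^+ (q.-1 - i) * z ^+ i.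
have -> : y - (z - w * (b * z ^+ q + a * x ^+ p - c)) =
    (y - z) * (1 - w * b * S).
  have : (y - z) * S = y ^+ q - z ^+ q by rewrite subrXX.
  rewrite -E; set P := y ^+ q; set P' := z ^+ q => H.
  transitivity ((y - z) - w * b * ((y - z) * S)); last by ring.
  rewrite H; ring.
rewrite exprSr dvdz_mul //.
have -> : 1 - w * b * S = u * l - w * b * (S - q%:Z * y0 ^+ q.-1).
  by rewrite -uw /dF; ring.
rewrite rpredB ?dvdz_mull //.
have -> : q%:Z * y0 ^+ q.-1 = \sum_(i < q) y0 ^+ (q.-1 - i) * y0 ^+ i.
  rewrite (eq_bigr (fun=> y0 ^+ q.-1)); last first.
    by move=> i _; rewrite -exprD subnK // -ltnS prednK.
  by rewrite sumr_const card_ord -mulr_natl; congr (_ * _); rewrite natz.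
rewrite -sumrB; apply: rpred_sum => i _.
set k := (_ - _)%N.
have -> : y ^+ k * z ^+ i - y0 ^+ k * y0 ^+ i =
  (y ^+ k - y0 ^+ k) * z ^+ i + y0 ^+ k * (z ^+ i - y0 ^+ i) by ring.
by apply: rpredD; [apply: dvdz_mulr | apply: dvdz_mull]; exact: dvdz_subX.
Qed.

(** Siegel's lemma by pigeonhole.  With [L = e^2] and [H = Q^L], there are
    [(H + 1)^(2L)] polynomials with coefficients in [[0, H]], and only
    [(Q^(2L))^L = H^(2L)] values for the first [L] Taylor coefficients at [x0]
    of [G(X, g(X))] modulo [Q^(2L)].  Two polynomials agree, and their
    difference works: the Taylor coefficients of index [m >= L] come with
    [(x - x0)^m], which is divisible by [Q^(2L)] by itself. *)
Lemma small_auxiliary_polynomial (g : {poly int}) (x0 : int) (Q e : nat) :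
  (0 < Q)%N -> (0 < e)%N ->
  exists v : nat -> nat -> int,
    [/\ exists i j, [/\ (i < 2 * e)%N, (j < e)%N & v i j != 0],
        forall i j, `|v i j| <= (Q ^ (e * e))%:Z &
        forall x : int, ((Q ^ 2)%N%:Z %| x - x0)%Z ->
        ((Q ^ (2 * (e * e)))%N%:Z %|
          \sum_(i < 2 * e) \sum_(j < e) v i j * x ^+ i * g.[x] ^+ j)%Z].
Proof.
move=> Q0 e0; set L := (e * e)%N; set H := (Q ^ L)%N.
set M := (Q ^ (2 * L))%N; have M0 : (0 < M)%N by rewrite expn_gt0 Q0.
have MP : M.-1.+1 = M by rewrite prednK.
have MZ : M%:Z != 0 by rewrite eqz_nat -lt0n.
have M0' : 0 < M%:Z by [].
pose I := ('I_(2 * e) * 'I_e)%type.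
pose h (f : I -> int) : {poly int} := \sum_i f i *: ('X ^+ i.1 * g ^+ i.2).
pose tc (f : I -> int) m := (h f \Po ('X + x0%:P))`_m.
pose phi (u : {ffun I -> 'I_H.+1}) : {ffun 'I_L -> 'I_M.-1.+1} :=
  [ffun m : 'I_L => inord `|(tc (fun i => (u i)%:Z) m %% M%:Z)%Z|%N].
have /injectivePn[u [u' uu' phiE]] : ~~ injectiveb phi.
  apply/negP => /injectiveP/leq_card; rewrite !card_ffun !card_ord MP.
  rewrite card_prod !card_ord leqNgt => /negP; apply.
  have -> : (M ^ L = H ^ (2 * e * e))%N by rewrite /M /H -!expnM; congr (_ ^ _)%N; rewrite /L; lia.
  by rewrite ltn_exp2r // muln_gt0 e0 muln_gt0 e0.
pose f i : int := (u i)%:Z - (u' i)%:Z.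
have tcM m : (m < L)%N -> (M%:Z %| tc f m)%Z.
  move=> mL.
  have hB : h f = h (fun i => (u i)%:Z) - h (fun i => (u' i)%:Z).
    by rewrite /h -sumrB; apply: eq_bigr => i _; rewrite scalerBl.
  rewrite /tc hB comp_polyB coefB -eqz_mod_dvd.
  have := congr1 (fun k : {ffun 'I_L -> 'I_M.-1.+1} => nat_of_ord (k (Ordinal mL))) phiE.
  have small (z : int) : (`|(z %% M%:Z)%Z|%N < M.-1.+1)%N.
    rewrite MP -ltz_nat gez0_abs ?modz_ge0 //.
    by rewrite ltz_pmod.
  rewrite !ffunE !inordK // /tc /=.
  move/(congr1 Posz); rewrite !gez0_abs ?modz_ge0 // => ->.
  by rewrite eqxx.
(* [f] is extended by [0] to all pairs of natural numbers. *)
pose v i j : int := if (insub i, insub j) is (Some i', Some j') then f (i', j') else 0.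
have vE (i : 'I_(2 * e)) (j : 'I_e) : v i j = f (i, j) by rewrite /v !valK.
exists v; split.
- have /existsP[[i j] uij] : [exists i, u i != u' i].
    by rewrite -negb_forall; apply: contra uu' => /eqfunP E; apply/eqP/ffunP.
  exists i, j; split=> //; rewrite vE /f subr_eq0.
  by apply: contra uij => /eqP[] /ord_inj->.
- move=> i j; rewrite /v; case: insub => [i'|//]; case: insub => [j'|//].
  rewrite /f; have := ltn_ord (u (i', j')); have := ltn_ord (u' (i', j')).
  rewrite !ltnS; lia.
move=> x xx0.
have -> : \sum_(i < 2 * e) \sum_(j < e) v i j * x ^+ i * g.[x] ^+ j = (h f).[x].
  rewrite pair_bigA /= /h horner_sum; apply: eq_bigr => -[i j] _ /=.
  by rewrite vE hornerZ hornerM !horner_exp hornerX mulrA.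
have -> : (h f).[x] = (h f \Po ('X + x0%:P)).[x - x0].
  by rewrite horner_comp !hornerE subrK.
rewrite horner_coef; apply: rpred_sum => m _.
have [mL|mL] := ltnP m L; first exact/dvdz_mulr/tcM.
apply: dvdz_mull; case/dvdzP: xx0 => k ->.
rewrite exprMn; apply: dvdz_mull.
by rewrite dvdzE abszX /= -expnM dvdn_exp2l // leq_mul2l.
Qed.

(** * Integral points on [a x^p + b y^q = c] *)

Lemma monomial_leq (p q r a b c n x y i j : nat) :
  (r <= p)%N -> (r <= q)%N -> (0 < a)%N -> (0 < b)%N -> (c <= n)%N ->
  (0 < x)%N -> (0 < y)%N -> (a * x ^ p + b * y ^ q = c)%N ->
  (i < 2 * r)%N -> (j < r)%N -> (x ^ i * y ^ j <= n ^ 3)%N.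
Proof.
move=> rp rq a0 b0 cn x0 y0 E ir jr.
have xn : (x ^ p <= n)%N.
  by apply: leq_trans cn; rewrite -E (leq_trans (leq_pmull _ a0)) ?leq_addr.
have yn : (y ^ q <= n)%N.
  by apply: leq_trans cn; rewrite -E (leq_trans (leq_pmull _ b0)) ?leq_addl.
rewrite (expnD n 2 1) leq_mul //.
  apply: leq_trans (_ : (x ^ p) ^ 2 <= _)%N; last by rewrite leq_exp2r.
  by rewrite -expnM leq_pexp2l //; lia.
by apply: leq_trans yn; rewrite leq_pexp2l //; lia.
Qed.

(** All points of the class are zeros of one auxiliary polynomial [G]:
    the integer [G(x, y)] is divisible by [Q^(2 r^2)], [Q = l^k], and too small
    to be anything but zero.  The condition on [k] is exactly what this
    comparison of sizes requires. *)
Lemma residue_class_bound (p q r : nat) : (0 < r)%N -> (r <= p)%N -> (r <= q)%N ->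
  exists K : nat, forall (l k n a b c x0 y0 : nat) (s : seq (nat * nat)),
    prime l -> (2 * r * r * n ^ 3 < (l ^ k) ^ (r * r))%N ->
    (0 < a)%N -> (0 < b)%N -> (c <= n)%N -> coprime l (b * q * y0) -> uniq s ->
    (forall z, z \in s -> [/\ (0 < z.1)%N, (0 < z.2)%N,
       (a * z.1 ^ p + b * z.2 ^ q = c)%N,
       (z.1 = x0 %[mod (l ^ k) ^ 2])%N & (z.2 = y0 %[mod l])%N]) ->
    (size s <= K)%N.
Proof.
move=> r0 rp rq; have p0 := leq_trans r0 rp; have q0 := leq_trans r0 rq.
have [K KP] := curve_auxiliary_zeros p q (2 * r) r p0 q0 rq.
exists K => l k n a b c x0 y0 s lp big a0 b0 cn cop us sP.
have [->//|[z0 z0s]] : s = [::] \/ exists z, z \in s.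
  by case: (s) => [|z s']; [left | right; exists z; rewrite mem_head].
have c0 : (0 < c)%N.
  have [x1 x2 <- _ _] := sP _ z0s.
  by rewrite addn_gt0 muln_gt0 a0 expn_gt0 x1.
set Q := (l ^ k)%N in big sP *.
have Q0 : (0 < Q)%N by rewrite expn_gt0 prime_gt0.
have copz : coprimez l%:Z (b%:Z * q%:Z * y0%:Z ^+ q.-1).
  move: cop; rewrite !coprimeMr => /andP[/andP[cb cq] cy].
  by rewrite !coprimezMr !coprimezE cb cq /= abszX coprimeXr.
have [g gP] := hensel_power_curve l%:Z p q a%:Z b%:Z c%:Z y0%:Z (k * (2 * (r * r))) q0 copz.
have [v [[i0 [j0 [i0r j0r v0]]] vH vP]] := small_auxiliary_polynomial g x0%:Z Q r Q0 r0.
apply: (KP a b c v i0 j0) => // -[x y] /sP[/= x1 y1 E xx0 yy0]; split=> //.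
apply/eqP; apply: contraTT big => nz; rewrite -leqNgt.
set S := \sum_(i < _) _ in nz.
have dvdS : ((Q ^ (2 * (r * r)))%N%:Z %| S)%Z.
  have Ez : a%:Z * x%:Z ^+ p + b%:Z * y%:Z ^+ q = c%:Z.
    by rewrite -E PoszD !PoszM -!natz !natrX.
  have yg := gP x%:Z y%:Z Ez.
  have /yg {}yg : (l%:Z %| y%:Z - y0%:Z)%Z.
    by rewrite -eqz_mod_dvd !modz_nat yy0.
  have xQ : ((Q ^ 2)%N%:Z %| x%:Z - x0%:Z)%Z.
    by rewrite -eqz_mod_dvd !modz_nat xx0.
  (* Replacing [y] by [g(x)] changes nothing modulo [Q^(2 r^2)]. *)
  have -> : S = \sum_(i < 2 * r) \sum_(j < r) v i j * x%:Z ^+ i * g.[x%:Z] ^+ j +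
      \sum_(i < 2 * r) \sum_(j < r) v i j * x%:Z ^+ i * (y%:Z ^+ j - g.[x%:Z] ^+ j).
    rewrite -big_split; apply: eq_bigr => i _; rewrite -big_split /=.
    by apply: eq_bigr => j _; rewrite mulrBr addrC subrK.
  rewrite rpredD ?vP //; apply: rpred_sum => i _; apply: rpred_sum => j _.
  apply/dvdz_mull/dvdz_subX; apply: dvdz_trans yg.
  by rewrite dvdzE abszX /= /Q -expnM.
have leS : `|S| <= (2 * r * r * Q ^ (r * r) * n ^ 3)%N%:Z.
  apply: le_trans (ler_norm_sum _ _ _) _.
  apply: le_trans (_ : \sum_(i < 2 * r) \sum_(j < r) (Q ^ (r * r) * n ^ 3)%N%:Z <= _).
    apply: ler_sum => i _; apply: le_trans (ler_norm_sum _ _ _) _.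
    apply: ler_sum => j _; rewrite -mulrA normrM PoszM ler_pM //.
    rewrite -!natz -!natrX -natrM normr_nat ler_nat.
    exact: (monomial_leq p q r a b c n x y i j).
  rewrite !sumr_const !card_ord -!mulrnA -[_ *+ _]mulr_natl natz -PoszM lez_nat.
  by rewrite leq_eqVlt; apply/orP; left; apply/eqP; ring.
have S0 : (0 < `|S|)%N by rewrite absz_gt0.
have : (Q ^ (2 * (r * r)) <= 2 * r * r * Q ^ (r * r) * n ^ 3)%N.
  apply: leq_trans (dvdn_leq S0 dvdS) _.
  by rewrite -lez_nat abszE.
rewrite mul2n -addnn expnD => H.
have QQ : (0 < Q ^ (r * r))%N by apply: leq_trans (leq_pexp2l Q0 (leq0n _)).
rewrite -(leq_pmul2l QQ); apply: leq_trans H _.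
by rewrite leq_eqVlt; apply/orP; left; apply/eqP; ring.
Qed.

Lemma size_fibre_leq (T : eqType) (F : finType) (f : T -> F) (s : seq T) K :
  (forall c, (size [seq x <- s | f x == c] <= K)%N) -> (size s <= #|F| * K)%N.
Proof.
move=> fK; rewrite -sum1_size (partition_big f xpredT) //=.
rewrite -sum_nat_const; apply: leq_sum => c _.
by rewrite -big_filter sum1_size.
Qed.

Lemma coprime_side (l x y : nat) : prime l -> coprime x y -> coprime l x || coprime l y.
Proof.
move=> lp cxy; rewrite !prime_coprime // -negb_and; apply/negP => /andP[lx ly].
have : (l %| gcdn x y)%N by rewrite dvdn_gcd lx.
by rewrite (eqP cxy) Euclid_dvd1.
Qed.

(** Here the points are those at which [l] misses the derivative in [y]; the
    others are reached by exchanging the two variables. *)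
Lemma coprime_side_bound (p q r : nat) : (0 < r)%N -> (r <= p)%N -> (r <= q)%N ->
  exists K : nat, forall (l k n a b c : nat) (s : seq (nat * nat)),
    prime l -> (q < l)%N -> (2 * r * r * n ^ 3 < (l ^ k) ^ (r * r))%N ->
    (0 < a)%N -> (0 < b)%N -> (c <= n)%N -> uniq s ->
    (forall z, z \in s -> [/\ (0 < z.1)%N, (0 < z.2)%N,
       (a * z.1 ^ p + b * z.2 ^ q = c)%N & coprime l (b * z.2)%N]) ->
    (size s <= (l ^ k) ^ 2 * l * K)%N.
Proof.
move=> r0 rp rq; have [K KP] := residue_class_bound p q r r0 rp rq.
exists K => l k n a b c s lp ql big a0 b0 cn us sP.
have l0 := prime_gt0 lp.
set Q2 := ((l ^ k) ^ 2)%N; have Q0 : (0 < Q2)%N by rewrite !expn_gt0 l0.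
pose f (z : nat * nat) : 'I_Q2 * 'I_l :=
  (Ordinal (ltn_pmod z.1 Q0), Ordinal (ltn_pmod z.2 l0)).
have -> : (Q2 * l = #|{: 'I_Q2 * 'I_l}|)%N by rewrite card_prod !card_ord.
apply: (@size_fibre_leq _ _ f) => -[i j].
set t := [seq _ <- _ | _].
have tP z : z \in t -> [/\ z \in s, (z.1 = i %[mod Q2])%N & (z.2 = j %[mod l])%N].
  rewrite mem_filter => /andP[/eqP[E1 E2] zs]; split=> //.
    by rewrite -E1 /= modn_mod.
  by rewrite -E2 /= modn_mod.
have [->//|[z0 /tP[z0s _ z0j]]] : t = [::] \/ exists z, z \in t.
  by case: (t) => [|z s']; [left | right; exists z; rewrite mem_head].
apply: (KP l k n a b c i j t) => //; last 2 first.
- exact: filter_uniq.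
- by move=> z /tP[/sP[? ? ? _] ? ?]; split.
have [z1 z2 _] := sP _ z0s; rewrite !coprimeMr => /andP[-> cz].
have -> : coprime l j by rewrite -coprime_modr -z0j coprime_modr.
rewrite /= andbT prime_coprime //;  apply/negP => /dvdn_leq.
by move=> /(_ (leq_trans r0 rq)); rewrite leqNgt ql.
Qed.

Lemma power_just_above (l R X : nat) : (1 < l)%N -> (0 < R)%N -> (0 < X)%N ->
  exists k, (X < (l ^ k) ^ R <= l ^ R * X)%N.
Proof.
move=> l1 R0 X0.
have ex : exists k, (X < (l ^ k) ^ R)%N.
  exists X; apply: leq_trans (ltn_expl X l1) _.
  by rewrite -expnM leq_pexp2l ?(ltnW l1) // leq_pmulr.
case: (ex_minnP ex) => k kX kmin; exists k; rewrite kX /=.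
case: k kX kmin => [|k] kX kmin.
  by move: kX; rewrite expn0 exp1n ltnNge X0.
rewrite expnS expnMn leq_mul2l; apply/orP; right; rewrite leqNgt.
by apply/negP => /kmin; rewrite ltnn.
Qed.

(** The inequality for [M] means [M = O(n^(6/r^2))].  The power [Q = l^k] is the
    least one allowed by [residue_class_bound], so [Q^(r^2)] is [O(n^3)], and
    the number of classes [(x mod Q^2, y mod l)] is [O(Q^2)]. *)
Lemma superelliptic_points_bound (p q r : nat) :
  (0 < r)%N -> (r <= p)%N -> (r <= q)%N ->
  exists K : nat, forall n : nat, (0 < n)%N ->
  exists2 M : nat, (M ^ (r * r) <= K * n ^ 6)%N &
  forall (a b c : nat) (s : seq (nat * nat)),
    (0 < a)%N -> (0 < b)%N -> (c <= n)%N -> uniq s ->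
    (forall z, z \in s -> [/\ (0 < z.1)%N, (0 < z.2)%N,
       (a * z.1 ^ p + b * z.2 ^ q = c)%N & coprime (a * z.1) (b * z.2)]) ->
    (size s <= M)%N.
Proof.
move=> r0 rp rq.
have [K1 K1P] := coprime_side_bound p q r r0 rp rq.
have [K2 K2P] := coprime_side_bound q p r r0 rq rp.
have [l lpq lp] := prime_above (p + q).
have RR : (0 < r * r)%N by rewrite muln_gt0 r0.
pose W := (l ^ (r * r) * (2 * r * r))%N.
exists ((l * (K1 + K2)) ^ (r * r) * W ^ 2)%N => n n0.
have X0 : (0 < 2 * r * r * n ^ 3)%N by rewrite !(muln_gt0, expn_gt0) r0 n0.
have [k /andP[kX kW]] := power_just_above l (r * r) _ (prime_gt1 lp) RR X0.
exists ((l ^ k) ^ 2 * l * (K1 + K2))%N.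
  set Q := (l ^ k)%N in kW *; set R := (r * r)%N in kW *.
  have -> : ((Q ^ 2 * l * (K1 + K2)) ^ R = (l * (K1 + K2)) ^ R * (Q ^ R) ^ 2)%N.
    by rewrite -mulnA expnMn mulnC -!expnM [(2 * R)%N]mulnC.
  have -> : ((l * (K1 + K2)) ^ R * W ^ 2 * n ^ 6 =
      (l * (K1 + K2)) ^ R * (W * n ^ 3) ^ 2)%N by rewrite (expnMn W) -expnM mulnA.
  by rewrite leq_mul2l leq_exp2r // /W -mulnA kW orbT.
move=> a b c s a0 b0 cn us sP.
rewrite -(count_predC (fun z => coprime l (b * z.2)) s) mulnDr leq_add //.
  rewrite -size_filter; apply: (K1P l k n a b c) => //; first by lia.
    exact: filter_uniq.
  by move=> z; rewrite mem_filter => /andP[? /sP[]].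
rewrite -size_filter -(size_map (fun z => (z.2, z.1))).
apply: (K2P l k n b a c) => //; first by lia.
  rewrite map_inj_uniq ?filter_uniq // => -[x y] [x' y'] [-> ->] //.
move=> _ /mapP[[x y] + ->]; rewrite mem_filter /= => /andP[nc /sP[/= x0 y0 E cxy]].
split=> //; first by rewrite addnC.
by have := coprime_side _ _ _ lp cxy; rewrite (negPf nc) orbF.
Qed.

(** * Reduction to factored solutions *)

Lemma S_full_in m a : S_ m a -> full_in (leq m) a.
Proof.
case=> a0 [_ am]; rewrite /full_in a0; apply/allP => l la.
have [lp _ _] := and3P (etrans (esym (mem_primes l a)) la).
by case: (am l lp) => // l0; move: la; rewrite -logn_gt0 l0.
Qed.

(** The triples counted by [N] as elements of a finite type; as [a + b = c], the
    condition [gcd(a, b, c) = 1] amounts to [coprime a b]. *)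
Definition abc_ord (p q r n : nat) (t : 'I_n.+1 * 'I_n.+1 * 'I_n.+1) : bool :=
  [&& full_in (leq p) t.1.1, full_in (leq q) t.1.2, full_in (leq r) t.2,
      coprime t.1.1 t.1.2 & (t.1.1 + t.1.2 == t.2)%N].

Lemma N_leq_card (R : realType) (p q r : nat) (B : R) : 1 <= B ->
  (N p q r B <= #|abc_ord p q r (Num.truncn B)|)%N.
Proof.
move=> B1; rewrite /N; set A := fset_set _; set n := Num.truncn B.
pose g (t : nat * nat * nat) : 'I_n.+1 * 'I_n.+1 * 'I_n.+1 :=
  (inord t.1.1, inord t.1.2, inord t.2).
have bnd k : (k%:R : R) \in `[1, B] -> (k < n.+1)%N.
  rewrite in_itv => /andP[_ kB] /=; rewrite ltnS truncn_ge_nat //.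
  exact: le_trans ler01 B1.
have AP a b c : (a, b, c) \in A -> [/\ (a < n.+1)%N, (b < n.+1)%N, (c < n.+1)%N &
  [&& full_in (leq p) a, full_in (leq q) b, full_in (leq r) c, coprime a b & (a + b == c)%N]].
  rewrite in_fset_set; last exact: finite_abc_triples.
  rewrite inE => -[[/S_full_in-> /S_full_in-> /S_full_in->]].
  move=> [[/bnd -> /bnd -> /bnd ->]] [g1 abc]; split=> //=; rewrite abc eqxx andbT.
  by rewrite /coprime -g1 -abc gcdnDr [gcdn b a]gcdnC gcdnA gcdnn.
have gval t : t \in A -> ((g t).1.1 : nat, (g t).1.2 : nat, (g t).2 : nat) = t.
  by case: t => [[a b] c] /AP[an bn cn _]; rewrite /g /= !inordK.
have inj : {in A &, injective g}.
  by move=> s t sA tA E; rewrite -(gval s sA) -(gval t tA) E.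
rewrite -(size_map g) -(card_uniqP _); last first.
  by rewrite map_inj_in_uniq ?fset_uniq //.
apply/subset_leq_card/fintype.subsetP => _ /mapP[t tA ->].
rewrite unfold_in /abc_ord; move: (tA) (gval t tA); case: t tA => [[a b] c] _ /AP[_ _ _ abc].
by case=> -> -> ->.
Qed.

Lemma powR_ge1 (R : realType) (x s : R) : 1 <= x -> 0 <= s -> 1 <= x `^ s.
Proof. by move=> x1 s0; rewrite -(powRr0 x) ler_powR. Qed.

Lemma powR_div (R : realType) (x y s : R) : 0 <= x -> 0 <= y ->
  (x / y) `^ s = x `^ s * y `^ (- s).
Proof.
by move=> x0 y0; rewrite powRM ?invr_ge0 // -powR_inv1 // -powRrM mulN1r.
Qed.

Lemma root_bound (R : realType) (M K n d j : nat) (B : R) : (0 < d)%N -> 0 <= B ->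
  n%:R <= B -> (M ^ d <= K * n ^ j)%N ->
  M%:R <= (K%:R `^ (d%:R^-1)) * B `^ (j%:R / d%:R).
Proof.
move=> d0 B0 nB MK; have dR : (d%:R : R) != 0 by rewrite pnatr_eq0 -lt0n.
have -> : (M%:R : R) = (M ^ d)%:R `^ d%:R^-1.
  by rewrite natrX -powR_mulrn ?ler0n // -powRrM divff // powRr1 ?ler0n.
rewrite powRrM powR_mulrn // -powRM ?ler0n ?exprn_ge0 //.
apply: ge0_ler_powR; rewrite ?invr_ge0 ?ler0n ?nnegrE ?mulr_ge0 ?exprn_ge0 ?ler0n //.
apply: le_trans (_ : (K * n ^ j)%:R <= _); first by rewrite ler_nat.
by rewrite natrM natrX ler_wpM2l ?ler0n // lerXn2r ?nnegrE ?ler0n.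
Qed.

(** A solution [a' x^p + b' y^q = c] is indexed by [(((a', b'), c), (x, y))], so
    that the first component is what stays fixed when points on a curve are
    counted. *)
Definition solution_index n := ((('I_n.+1 * 'I_n.+1) * 'I_n.+1) * ('I_n.+1 * 'I_n.+1))%type.

Definition full_coef (p q r n : nat) (k : ('I_n.+1 * 'I_n.+1) * 'I_n.+1) : bool :=
  [&& full_in (leq p.+1) k.1.1, full_in (leq q.+1) k.1.2 & full_in (leq r) k.2].

Definition main_vars (p q n : nat) (k : ('I_n.+1 * 'I_n.+1) * 'I_n.+1)
    (z : 'I_n.+1 * 'I_n.+1) : bool :=
  [&& (0 < z.1)%N, (0 < z.2)%N, (k.1.1 * z.1 ^ p + k.1.2 * z.2 ^ q == k.2)%N
    & coprime (k.1.1 * z.1) (k.1.2 * z.2)].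

Lemma card_abc_ord_leq (R : realType) (p q r n : nat) : (0 < p)%N -> (0 < q)%N ->
  #|abc_ord p q r n|%:R <=
    \sum_(j : solution_index n | full_coef p q r n j.1 && main_vars p q n j.1 j.2) (1 : R).
Proof.
move=> p0 q0; rewrite -sum1_card natr_sum.
apply: (@ler_sum_cover R _ _ _ _ (fun (i : 'I_n.+1 * 'I_n.+1 * 'I_n.+1) (j : solution_index n) =>
  [&& i.1.1 == j.1.1.1 * j.2.1 ^ p :> nat, i.1.2 == j.1.1.2 * j.2.2 ^ q :> nat
    & i.2 == j.1.2])%N) => //; last first.
  move=> [[a b] c] [[a' b'] c'] [[k1 k2] z] /= /and3P[/eqP E1 /eqP E2 /eqP->].
  by case/and3P=> /eqP E3 /eqP E4 /eqP->; do 2?congr pair; apply: ord_inj; rewrite ?E1 ?E2.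
move=> [[a b] c]; rewrite unfold_in => /and5P[/= fa fb fc cab /eqP abc].
have split m (e : 'I_n.+1) : (0 < m)%N -> full_in (leq m) e ->
    exists x z : 'I_n.+1, [/\ (0 < x)%N, full_in (leq m.+1) z & (e = z * x ^ m :> nat)%N].
  move=> m0 /(full_in_split _ (leq m.+1) m _ m0)[].
    move=> k mk; have [->|km] := eqVneq k m; [right|left]; last lia.
    by split=> //; left.
  move=> x [z [x0 fz eE]]; have z0 : (0 < z)%N by case/andP: fz.
  have xn : (x < n.+1)%N.
    apply: leq_ltn_trans (ltn_ord e); rewrite eE.
    by rewrite (leq_trans _ (leq_pmulr _ z0)) // -{1}[x]expn1 leq_pexp2l.
  have zn : (z < n.+1)%N.
    by apply: leq_ltn_trans (ltn_ord e); rewrite eE leq_pmull // expn_gt0 x0.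
  by exists (Ordinal xn), (Ordinal zn); rewrite eE mulnC.
have [x [a' [x0 fa' aE]]] := split _ _ p0 fa.
have [y [b' [y0 fb' bE]]] := split _ _ q0 fb.
exists (((a', b'), c), (x, y)); rewrite /= ?aE ?bE ?eqxx //.
rewrite /full_coef /main_vars /= fa' fb' fc x0 y0 /= -aE -bE abc eqxx /=.
move: cab; rewrite aE bE.
by rewrite !coprimeMl !coprimeMr !(coprime_pexpl, coprime_pexpr) //.
Qed.

(** * The two ranges of [a' b'] *)

(** Rankin's trick: each term [1] is at most
    [(B/a)^s (B/b)^t (a' b' / T)^th] with [s = 1/p + e1], [t = 1/q + e1] and
    [th = 1/p - 1/(p+1)].  This is the largest [th] for which the sum over
    [(p+1)]-full [a'] of [a'^(th - s)] still converges for all [e1 > 0]; for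
    [b'] there is room, as [q <= p]. *)
Lemma count_small_main_parts (R : realType) (p q r : nat) (e1 : R) :
  (0 < p)%N -> (q <= p)%N -> (0 < q)%N -> 0 < e1 ->
  exists2 C : R, 0 < C & forall (n : nat) (B T : R), n%:R <= B -> 0 < B -> 0 < T ->
    \sum_(j : solution_index n | (full_coef p q r n j.1 && main_vars p q n j.1 j.2) &&
        (T <= (j.1.1.1 * j.1.1.2)%:R)) (1 : R) <=
    C * (B `^ (p%:R^-1 + e1 + (q%:R^-1 + e1)) * T `^ (- (p * p.+1)%:R^-1)).
Proof.
move=> p0 qp q0 e0.
set s := _ + e1; set t := _ + e1; set th : R := (p * p.+1)%:R^-1.
have pR : (0 : R) < p%:R by rewrite ltr0n.
have qR : (0 : R) < q%:R by rewrite ltr0n.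
have th0 : 0 < th by rewrite invr_gt0 ltr0n muln_gt0 p0.
have s0 : 0 < s by rewrite addr_gt0 ?invr_gt0.
have t0 : 0 < t by rewrite addr_gt0 ?invr_gt0.
have [Z1 Z1P] : exists C : R, forall n, \sum_(x < n.+1 | (0 < x)%N) (x%:R : R) `^ (- (s * p%:R)) <= C.
  by apply: zeta_partial_sum_bound; rewrite /s mulrDl mulVf ?gt_eqF // ltrDl mulr_gt0.
have [Z2 Z2P] : exists C : R, forall n, \sum_(x < n.+1 | (0 < x)%N) (x%:R : R) `^ (- (t * q%:R)) <= C.
  by apply: zeta_partial_sum_bound; rewrite /t mulrDl mulVf ?gt_eqF // ltrDl mulr_gt0.
have thE : th = p%:R^-1 - p.+1%:R^-1.
  rewrite /th natrM; have : (p.+1%:R : R) != 0 by rewrite pnatr_eq0.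
  have := lt0r_neq0 pR; rewrite -[p.+1]addn1 natrD => *; field; exact/andP.
have thq : th <= q%:R^-1 - q.+1%:R^-1.
  have -> : q%:R^-1 - q.+1%:R^-1 = (q * q.+1)%:R^-1 :> R.
    rewrite natrM; have : (q.+1%:R : R) != 0 by rewrite pnatr_eq0.
    have := lt0r_neq0 qR; rewrite -[q.+1]addn1 natrD => *; field; exact/andP.
  by rewrite /th lef_pV2 ?posrE ?ltr0n ?muln_gt0 ?p0 ?q0 // ler_nat leq_mul.
have [F1 F10 F1P] : exists2 C : R, 0 < C & forall n, full_sum (leq p.+1) (s - th) n <= C.
  apply: full_sum_bounded => //.
  have -> : s - th = p.+1%:R^-1 + e1 by rewrite /s thE; ring.
  by rewrite mulrDl mulVf ?pnatr_eq0 // ltrDl mulr_gt0 ?ltr0n.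
have [F2 F20 F2P] : exists2 C : R, 0 < C & forall n, full_sum (leq q.+1) (t - th) n <= C.
  apply: full_sum_bounded => //.
  apply: lt_le_trans (_ : (q.+1%:R^-1 + e1) * q.+1%:R <= _).
    by rewrite mulrDl mulVf ?pnatr_eq0 // ltrDl mulr_gt0 ?ltr0n.
  rewrite ler_wpM2r ?ler0n // /t; move: thq.
  by set x := q%:R^-1; set y := q.+1%:R^-1; lra.
pose Z (u : R) n : R := \sum_(x < n.+1 | (0 < x)%N) (x%:R : R) `^ (- u).
have Z0 u n : 0 <= Z u n by apply: sumr_ge0 => x _; exact: powR_ge0.
have Z1p : 0 < Num.max Z1 1 by rewrite lt_max ltr01 orbT.
have Z2p : 0 < Num.max Z2 1 by rewrite lt_max ltr01 orbT.
exists (Num.max Z1 1 * F1 * (Num.max Z2 1 * F2)) => [|n B T nB B0 T0].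
  by rewrite !mulr_gt0.
set W := B `^ _ * _; have W0 : 0 <= W by rewrite mulr_ge0 ?powR_ge0.
apply: le_trans (_ : W * (Z (s * p%:R) n * full_sum (leq p.+1) (s - th) n *
   (Z (t * q%:R) n * full_sum (leq q.+1) (t - th) n)) <= _); last first.
  rewrite mulrC ler_wpM2r // ler_pM ?mulr_ge0 ?full_sum_ge0 //.
    by rewrite ler_pM ?full_sum_ge0 // le_max Z1P.
  by rewrite ler_pM ?full_sum_ge0 // le_max Z2P.
rewrite /full_sum /Z.
clearbody s t th.
rewrite [X in W * (X * _)]big_distrlr [X in W * (X * _)]pair_big /=.
rewrite [X in W * (_ * X)]big_distrlr [X in W * (_ * X)]pair_big /=.
rewrite big_distrlr pair_big big_distrr /=.
apply: (@ler_sum_cover R _ _ _ _ (fun (j : solution_index n) (k : ('I_n.+1 * 'I_n.+1) * ('I_n.+1 * 'I_n.+1)) =>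
  [&& k == ((j.2.1, j.1.1.1), (j.2.2, j.1.1.2)) & main_vars p q n j.1 j.2])).
- move=> [[[a b] c] [x y]] /andP[/andP[/and3P[/= fa fb _] mv] _].
  exists ((x, a), (y, b)); last by rewrite /= eqxx.
  by case/and4P: mv => /= x0 y0 _ _; rewrite x0 y0 fa fb.
- move=> [[[a b] c] [x y]] [[[a' b'] c'] [x' y']] k /= /andP[/eqP-> mv] /andP[/eqP[<- <- <- <-]].
  case/and4P: mv => _ _ /= /eqP cE _ /and4P[_ _ /= /eqP cE' _].
  by do 3?congr pair; apply: ord_inj; rewrite -cE -cE'.
- move=> [[[a b] c] [x y]] k /andP[/andP[/and3P[/= fa fb _] mv] Tab] _ /andP[/eqP-> _] /=.
  case/and4P: mv => /= x0 y0 /eqP cE _.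
  have a0 : (0 < a)%N by case/andP: fa.
  have b0 : (0 < b)%N by case/andP: fb.
  have aB : ((a * x ^ p)%:R : R) <= B.
    apply: le_trans nB; rewrite ler_nat -ltnS; apply: leq_ltn_trans (ltn_ord c).
    by rewrite -cE leq_addr.
  have bB : ((b * y ^ q)%:R : R) <= B.
    apply: le_trans nB; rewrite ler_nat -ltnS; apply: leq_ltn_trans (ltn_ord c).
    by rewrite -cE leq_addl.
  have pos m : (0 < m)%N -> (0 : R) < m%:R by rewrite ltr0n.
  have := powR_ge1 _ (B / (a * x ^ p)%:R) s.
  rewrite ler_pdivlMr ?pos ?muln_gt0 ?a0 ?expn_gt0 ?x0 // mul1r => /(_ aB (ltW s0)) H1.
  have := powR_ge1 _ (B / (b * y ^ q)%:R) t.
  rewrite ler_pdivlMr ?pos ?muln_gt0 ?b0 ?expn_gt0 ?y0 // mul1r => /(_ bB (ltW t0)) H2.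
  have := powR_ge1 _ ((a * b)%:R / T) th.
  rewrite ler_pdivlMr // mul1r => /(_ Tab (ltW th0)) H3.
  apply: (@le_trans _ _ ((B / (a * x ^ p)%:R) `^ s * (B / (b * y ^ q)%:R) `^ t * ((a * b)%:R / T) `^ th)).
    by rewrite -[leLHS]mulr1 ler_pM // -[leLHS]mulr1 ler_pM.
  rewrite !powR_div ?ler0n ?(ltW T0) ?(ltW B0) // !natrM !natrX !powRM ?exprn_ge0 ?ler0n //.
  rewrite -!(powR_mulrn _ (ler0n _ _)) -!powRrM /W.
  have nz m : (0 < m)%N -> (m%:R : R) != 0 by rewrite pnatr_eq0 -lt0n.
  rewrite (@powRD _ B s t) ?(gt_eqF B0) ?implybT //.
  rewrite !opprB !(addrC th) !powRD ?nz ?implybT //.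
  rewrite le_eqVlt; apply/orP; left; apply/eqP.
  rewrite !mulrN !(mulrC _%:R).
  ring.
- by move=> k _; rewrite !mulr_ge0 ?powR_ge0.
Qed.

(** For each of the triples [(a', b', c)] the number of points on the curve is
    at most [M = O(B^(6/r^2))], and the triples are counted with Rankin's weight
    [(B/c)^s (T/(a' b'))^s], [s = 1/r + e1]; [1/r] is forced by the [r]-full
    [c]. *)
Lemma count_large_main_parts (R : realType) (p q r : nat) (e1 : R) :
  (0 < r)%N -> (r <= p)%N -> (r <= q)%N -> 0 < e1 ->
  exists2 C : R, 0 < C & forall (n : nat) (B T : R),
    (0 < n)%N -> n%:R <= B -> 0 < T ->
    \sum_(j : solution_index n | (full_coef p q r n j.1 && main_vars p q n j.1 j.2) &&
        ~~ (T <= (j.1.1.1 * j.1.1.2)%:R)) (1 : R) <=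
    C * (B `^ (6%:R / (r * r)%:R) * B `^ (r%:R^-1 + e1) * T `^ (r%:R^-1 + e1)).
Proof.
move=> r0 rp rq e0; set s := _ + e1.
have rR : (0 : R) < r%:R by rewrite ltr0n.
have s0 : 0 < s by rewrite addr_gt0 ?invr_gt0.
have bounded m : (r <= m)%N -> exists2 C : R, 0 < C & forall n, full_sum (leq m) s n <= C.
  move=> rm; apply: full_sum_bounded; first exact: leq_trans rm.
  apply: lt_le_trans (_ : s * r%:R <= _); last by rewrite ler_pM2l // ler_nat.
  by rewrite /s mulrDl mulVf ?gt_eqF // ltrDl mulr_gt0.
have [F1 F10 F1P] := bounded _ (leqW rp).
have [F2 F20 F2P] := bounded _ (leqW rq).
have [F3 F30 F3P] := bounded _ (leqnn r).
have [K KP] := superelliptic_points_bound p q r r0 rp rq.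
have K1 : 0 < (K.+1%:R : R) `^ (r * r)%:R^-1 by rewrite powR_gt0 ?ltr0n.
exists ((K.+1%:R : R) `^ (r * r)%:R^-1 * (F1 * F2 * F3)) => [|n B T n0 nB T0].
  by rewrite !mulr_gt0.
have B0 : 0 < B by apply: lt_le_trans nB; rewrite ltr0n.
have [M MK MP] := KP n n0.
have MB : M%:R <= (K.+1%:R : R) `^ (r * r)%:R^-1 * B `^ (6%:R / (r * r)%:R).
  apply: root_bound (ltW B0) nB _; first by rewrite muln_gt0 r0.
  by apply: leq_trans MK _; rewrite leq_mul2r leqnSn orbT.
rewrite (eq_bigl (fun j : solution_index n =>
  (full_coef p q r n j.1 && ~~ (T <= (j.1.1.1 * j.1.1.2)%:R)) && main_vars p q n j.1 j.2));
  last by move=> j; rewrite andbAC.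
rewrite -(pair_big_dep (fun k => full_coef p q r n k && ~~ (T <= (k.1.1 * k.1.2)%:R))
  (main_vars p q n) (fun _ _ => 1 : R)) /=.
pose W := B `^ (6%:R / (r * r)%:R) * B `^ s * T `^ s; rewrite -/W.
apply: le_trans (_ : \sum_(k | full_coef p q r n k)
   (M%:R * (B `^ s * T `^ s)) *
   (k.1.1%:R `^ (- s) * k.1.2%:R `^ (- s) * k.2%:R `^ (- s)) <= _).
  apply: (@ler_sum_cover R _ _ _ _ (fun i j => i == j)).
  - by move=> k /andP[fk _]; exists k.
  - by move=> i i' j /eqP -> /eqP.
  - move=> [[a b] c] k /andP[fk]; rewrite -ltNge /= => abT _ /eqP <- {k}.
    case/and3P: (fk) => /= /andP[a0 _] /andP[b0 _] /andP[c0 _].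
    have fibre : \sum_(z | main_vars p q n ((a, b), c) z) (1 : R) <= M%:R.
      rewrite sumr_const ler_nat cardE.
      pose g (z : 'I_n.+1 * 'I_n.+1) := (z.1 : nat, z.2 : nat).
      rewrite -(size_map g); apply: (MP a b c) => //; first by rewrite -ltnS.
        rewrite map_inj_uniq ?enum_uniq // => -[x y] [x' y'] [/ord_inj-> /ord_inj->] //.
      move=> _ /mapP[z + ->]; rewrite mem_enum unfold_in => /and4P[z1 z2 /eqP zE cz].
      by split.
    apply: le_trans fibre _; rewrite -[leLHS]mulr1 -mulrA ler_wpM2l ?ler0n //.
    have cB : (c%:R : R) <= B by apply: le_trans nB; rewrite ler_nat -ltnS.
    have := powR_ge1 _ (B / c%:R) s; rewrite ler_pdivlMr ?ltr0n // mul1r.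
    move=> /(_ cB (ltW s0)) H1.
    have := powR_ge1 _ (T / (a * b)%:R) s.
    rewrite ler_pdivlMr ?ltr0n ?muln_gt0 ?a0 // mul1r => /(_ (ltW abT) (ltW s0)) H2.
    apply: le_trans (_ : (B / c%:R) `^ s * (T / (a * b)%:R) `^ s <= _).
      by rewrite -[leLHS]mulr1 ler_pM.
    rewrite !powR_div ?ler0n ?(ltW T0) ?(ltW B0) // natrM powRM ?ler0n //.
    by rewrite le_eqVlt; apply/orP; left; apply/eqP; ring.
  - move=> k _; rewrite !mulr_ge0 ?powR_ge0 ?ler0n //.
rewrite -big_distrr /=.
have -> : \sum_(k | full_coef p q r n k)
    (k.1.1%:R `^ (- s) * k.1.2%:R `^ (- s) * k.2%:R `^ (- s)) =
    full_sum (leq p.+1) s n * full_sum (leq q.+1) s n * full_sum (leq r) s n.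
  rewrite /full_sum [X in _ = X * _]big_distrlr [X in _ = X * _]pair_big /=.
  rewrite big_distrlr pair_big /=.
  by apply: eq_bigl => k; rewrite /full_coef andbA.
set D := _ `^ (r * r)%:R^-1 in MB K1 *.
have -> : D * (F1 * F2 * F3) * W =
    D * B `^ (6%:R / (r * r)%:R) * (B `^ s * T `^ s) * (F1 * F2 * F3).
  by rewrite /W; ring.
rewrite ler_pM ?mulr_ge0 ?powR_ge0 ?full_sum_ge0 ?ler0n //.
  by rewrite ler_wpM2r ?mulr_ge0 ?powR_ge0.
by rewrite !ler_pM ?mulr_ge0 ?full_sum_ge0.
Qed.

(** * The saving *)

(** The solutions are split at [a' b' = B^(1 - cutoff_deficit)].  The constant
    is dictated by [large_case_exponent]: [6] pays for the points on the curves, [1] for the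
    saving and [2u] for replacing [1/p + 1/q] by [2/r]. *)
Definition cutoff_deficit (R : realType) (u r : nat) : R := (7 + 2 * u)%:R / r%:R.

Definition saving (R : realType) (u r : nat) : R :=
  (1 - cutoff_deficit R u r) / ((r + u) * (r + u).+1)%:R.

Lemma saving_asymptotic (R : realType) (u r : nat) : (7 + 2 * u < r)%N ->
  `|saving R u r - 1 / r%:R ^+ 2| <=
    (8 + 4 * u + u * u.+1)%:R * r%:R `^ (- (5 / 2)).
Proof.
move=> ur; have rR : (0 : R) < r%:R by rewrite ltr0n; lia.
have r1 : (1 : R) <= r%:R by rewrite ler1n; lia.
apply: le_trans (_ : (8 + 4 * u + u * u.+1)%:R * (r%:R ^+ 3)^-1 <= _); last first.
  rewrite ler_wpM2l ?ler0n // -powR_mulrn ?ler0n // -powRN ler_powR //; lra.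
rewrite /saving /cutoff_deficit.
set D := ((r + u) * (r + u).+1)%:R.
have DE : D = r%:R ^+ 2 + (2 * u%:R + 1) * r%:R + u%:R * (u%:R + 1) :> R.
  by rewrite /D natrM -addn1 !natrD; ring.
have -> : (8 + 4 * u + u * u.+1)%:R = 8 + 4 * u%:R + u%:R * (u%:R + 1) :> R.
  by rewrite -[u.+1]addn1 !natrD !natrM !natrD; ring.
have -> : (7 + 2 * u)%:R = 7 + 2 * u%:R :> R by rewrite natrD natrM.
have u0 : (0 : R) <= u%:R by rewrite ler0n.
set x : R := r%:R in rR r1 DE *; set y : R := u%:R in u0 DE *.
have D0 : 0 < D by rewrite DE; nra.
have -> : (1 - (7 + 2 * y) / x) / D - 1 / x ^+ 2 =
    - (((2 * y + 1) * x ^+ 2 + y * (y + 1) * x + (7 + 2 * y) * x ^+ 2) / (x ^+ 3 * D)).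
  rewrite DE in D0 *; field; rewrite !gt_eqF //.
rewrite normrN ger0_norm; last by rewrite divr_ge0 // ?mulr_ge0 // ?exprn_ge0 ?(ltW rR) ?(ltW D0) //; nra.
rewrite ler_pdivrMr ?mulr_gt0 ?exprn_gt0 //.
have -> (k : R) : k / x ^+ 3 * (x ^+ 3 * D) = k * D.
  by rewrite mulrA divfK // expf_neq0 // gt_eqF.
rewrite DE; nra.
Qed.

Lemma saving_gt0 (R : realType) (u r : nat) : (7 + 2 * u < r)%N -> 0 < saving R u r.
Proof.
move=> ur; rewrite /saving divr_gt0 ?ltr0n ?muln_gt0 //; last by rewrite addn_gt0; lia.
by rewrite subr_gt0 /cutoff_deficit ltr_pdivrMr ?ltr0n ?mul1r ?ltr_nat //; lia.
Qed.

(** Dropping [a' b'] below [B^(1-d)] gains [d/r = (7 + 2u)/r^2], which covers the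
    [6/r^2] lost to the points on the curves, the differences
    [1/r - 1/p <= u/r^2] and [1/r - 1/q <= u/r^2], and a saving of at most
    [1/r^2]. *)
Lemma large_case_exponent (R : realType) (u v r : nat) (e : R) :
  (v <= u)%N -> (7 + 2 * u < r)%N -> 0 <= e ->
  6%:R / (r * r)%:R + (r%:R^-1 + e / 2) + (1 - cutoff_deficit R u r) * (r%:R^-1 + e / 2) <=
    1 / (r + u)%:R + 1 / (r + v)%:R - saving R u r + e.
Proof.
move=> vu ur e0; have rR : (0 : R) < r%:R by rewrite ltr0n; lia.
have r0 : (r%:R : R) != 0 by rewrite gt_eqF.
have inv_ge w : (w <= u)%N -> r%:R^-1 - u%:R / r%:R ^+ 2 <= 1 / (r + w)%:R :> R.
  move=> wu; have wR : (0 : R) <= w%:R by rewrite ler0n.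
  have wuR : (w%:R : R) <= u%:R by rewrite ler_nat.
  rewrite ler_pdivlMr ?ltr0n ?addn_gt0; last by apply/orP; left; lia.
  rewrite natrD; set x : R := r%:R in rR r0 *.
  have -> : (x^-1 - u%:R / x ^+ 2) * (x + w%:R) =
    1 - ((u%:R - w%:R) * x + u%:R * w%:R) / x ^+ 2 by field.
  rewrite gerBl divr_ge0 ?exprn_ge0 ?(ltW rR) // addr_ge0 ?mulr_ge0 ?subr_ge0 ?(ltW rR) ?ler0n //.
have Hu := inv_ge u (leqnn u); have Hv := inv_ge v vu.
have l0 : 0 <= cutoff_deficit R u r by rewrite /cutoff_deficit divr_ge0 ?ler0n.
have Hs : saving R u r <= 1 / r%:R ^+ 2.
  rewrite /saving ler_pdivlMr ?exprn_gt0 // mulrAC.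
  rewrite ler_pdivrMr ?mul1r; last by rewrite ltr0n muln_gt0 addn_gt0; lia.
  apply: le_trans (_ : r%:R ^+ 2 <= _).
    by rewrite ler_piMl ?exprn_ge0 ?(ltW rR) // gerBl.
  by rewrite -natrX ler_nat; nia.
have lE : (7 + 2 * u)%:R / r%:R / r%:R = 7 / r%:R ^+ 2 + 2 * (u%:R / r%:R ^+ 2) :> R.
  by rewrite natrD natrM; field.
have le0 : 0 <= cutoff_deficit R u r * (e / 2) by rewrite mulr_ge0 ?divr_ge0.
have -> : 6%:R / (r * r)%:R = 6 / r%:R ^+ 2 :> R by rewrite natrM expr2.
have lr : cutoff_deficit R u r * r%:R^-1 = 7 / r%:R ^+ 2 + 2 * (u%:R / r%:R ^+ 2) by rewrite -lE.
move: Hu Hv Hs le0 lr.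
rewrite !div1r mulrBl mul1r mulrDr => Hu Hv Hs le0 ->.
have i2 : 7 / r%:R ^+ 2 = 6 / r%:R ^+ 2 + (r%:R ^+ 2)^-1 :> R by field.
move: Hu Hv Hs le0; rewrite i2.
set a := r%:R^-1; set b := u%:R / _; set c := 6 / _; set d := (_ ^+ 2)^-1.
set f := (r + u)%:R^-1; set g := (r + v)%:R^-1; set l := cutoff_deficit _ _ _ * _.
lra.
Qed.

Theorem theorem1p1 (R : realType) (u v : nat) (hvu : (v <= u)%N) :
  exists (r0 : nat) (eta : nat -> R),
    (forall r : nat, (2 <= r)%N -> (r0 <= r)%N ->
      0 < eta r /\
      forall eps : R, 0 < eps ->
        exists C : R, 0 < C /\
          forall B : R, 1 <= B ->
            (N (r + u) (r + v) r B)%:R <=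
              C * B `^ (1 / (r + u)%:R + 1 / (r + v)%:R - eta r + eps)) /\
    (exists K : R, forall r : nat, (2 <= r)%N -> (r0 <= r)%N ->
      `|eta r - 1 / r%:R ^+ 2| <= K * r%:R `^ (- (5 / 2))).
Proof.
exists (8 + 2 * u)%N, (saving R u); split; last first.
  by exists (8 + 4 * u + u * u.+1)%:R => r _ ur; apply: saving_asymptotic.
move=> r _ ur; split; first exact: saving_gt0.
move=> eps eps0; have r0 : (0 < r)%N by lia.
have vpu : (r + v <= r + u)%N by rewrite leq_add2l.
have e20 : 0 < eps / 2 by rewrite divr_gt0.
have [C1 C10 C1P] := count_small_main_parts R (r + u) (r + v) r (eps / 2)
  (ltn_addr _ r0) vpu (ltn_addr _ r0) e20.
have [C2 C20 C2P] := count_large_main_parts R (r + u) (r + v) r (eps / 2)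
  r0 (leq_addr _ _) (leq_addr _ _) e20.
exists (C1 + C2); split=> [|B B1]; first exact: addr_gt0.
have B0 : 0 < B by exact: lt_le_trans B1.
set n := Num.truncn B.
have nB : n%:R <= B by rewrite /n truncn_le ltW.
have n0 : (0 < n)%N by rewrite truncn_gt0.
pose T := B `^ (1 - cutoff_deficit R u r); have T0 : 0 < T by rewrite powR_gt0.
apply: (@le_trans _ _ #|abc_ord (r + u) (r + v) r n|%:R).
  by rewrite ler_nat N_leq_card.
apply: le_trans (card_abc_ord_leq R (r + u) (r + v) r n (ltn_addr _ r0) (ltn_addr _ r0)) _.
rewrite (bigID (fun j : solution_index n => T <= (j.1.1.1 * j.1.1.2)%:R)) /= mulrDl lerD //.
  apply: le_trans (C1P n B T nB B0 T0) _; rewrite ler_pM2l //.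
  rewrite /T -powRrM -powRD ?(gt_eqF B0) ?implybT // ler_powR //.
  rewrite le_eqVlt; apply/orP; left; apply/eqP; rewrite /saving !div1r mulrN.
  set x := (1 - _) * _; lra.
apply: le_trans (C2P n B T n0 nB T0) _; rewrite ler_pM2l //.
rewrite /T -powRrM -!powRD ?(gt_eqF B0) ?implybT // ler_powR //.
exact: large_case_exponent (ltW eps0).
Qed.
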